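(* Let $2\le d\le \frac n2$ be integers. The Poincaré and log-Sobolev constants of $(\Omega^B_n(d),\pi_u,Q_u)$ are at least $nd/4$ and $\frac12 nd\log\big(\frac nd\big)$, respectively.
   Context: For $2\le d\le n$, $\Omega^B_n(d)$ is the set of all $d$-regular bipartite graphs without multiple edges on the labelled vertex set $[n]^{(\ell)}\sqcup[n]^{(r)}$ ($n$ left and $n$ right vertices), and $\pi_u$ is the uniform probability measure on it. A simple switching on a graph $G\in\Omega^B_n(d)$ takes two edges $(i,j),(i',j')$ of $G$ with $i\ne i'$, $j\neq j'$ and replaces them by $(i,j'),(i',j)$; it is admissible if neither $(i,j')$ nor $(i',j)$ is an edge of $G$. $\mathcal{N}(G)\subset\Omega^B_n(d)$ is the set of graphs obtained from $G$ by one admissible simple switching. The switch chain on $\Omega^B_n(d)$ has Markov generator $Q_u(G_1,G_2)=\big(nd(nd-1)/2\big)^{-1}$ if $G_2\in\mathcal{N}(G_1)$, $Q_u(G_1,G_1)=-|\mathcal{N}(G_1)|\big(nd(nd-1)/2\big)^{-1}$, and $Q_u(G_1,G_2)=0$ otherwise; it is reversible with respect to $\pi_u$. For a probability measure $\mu$ on a finite set $S$ and a generator $Q$ reversible with respect to $\mu$: $\mathcal{E}_\mu(f,f)=\frac12\sum_{x,y\in S}Q(x,y)(f(x)-f(y))^2\mu(x)$, $\mathrm{Var}_\mu(f)=\frac12\sum_{x,y\in S}\mu(x)\mu(y)(f(x)-f(y))^2$, and $\mathrm{Ent}_\mu(f^2)=\mathbb{E}_\mu\big[f^2(\log f^2-\log\mathbb{E}_\mu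 f^2)\big]$ (with $0\log0=0$). The Poincaré constant (resp. log-Sobolev constant) of $(S,\mu,Q)$ is the smallest $\alpha$ such that $\mathrm{Var}_\mu(f)\le\alpha\,\mathcal{E}_\mu(f,f)$ (resp. $\mathrm{Ent}_\mu(f^2)\le\alpha\,\mathcal{E}_\mu(f,f)$) for all functions $f:S\to\mathbb{R}$. *)

(* Defs.v *)
From HB Require Import structures.
From mathcomp Require Import all_boot all_order all_algebra.
From mathcomp Require Import all_classical all_reals all_analysis.
Set Implicit Arguments.
Unset Strict Implicit.
Unset Printing Implicit Defensive.
Import Order.TTheory GRing.Theory Num.Theory.
Local Open Scope ring_scope.

Section FiniteChains.
Context {R : realType} {S : finType}.
Implicit Types (mu : S -> R) (Q : S -> S -> R) (f : S -> R).

Definition expectation_fin mu f : R := \sum_x mu x * f x.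

Definition dirichlet mu Q f : R :=
  2^-1 * \sum_x \sum_y Q x y * (f x - f y) ^+ 2 * mu x.

Definition variance_fin mu f : R :=
  2^-1 * \sum_x \sum_y mu x * mu y * (f x - f y) ^+ 2.

(* Ent_mu(f^2); where f vanishes the integrand is 0 since [ln 0 = 0]. *)
Definition entropy_sqr mu f : R :=
  expectation_fin mu (fun x =>
    f x ^+ 2 * (ln (f x ^+ 2) - ln (expectation_fin mu (fun y => f y ^+ 2)))).

Definition poincare_admissible mu Q (a : R) : Prop :=
  forall f, variance_fin mu f <= a * dirichlet mu Q f.

Definition log_sobolev_admissible mu Q (a : R) : Prop :=
  forall f, entropy_sqr mu f <= a * dirichlet mu Q f.

(* The smallest element of [A], as an extended real: it is [+oo] when [A] is
   empty, and agrees with the least element whenever there is one. For the two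
   predicates above, which are intersections of closed conditions [v <= a * e], the
   infimum is attained whenever it is finite. *)
Definition least_constant (A : R -> Prop) : \bar R :=
  ereal_inf [set a%:E | a in [set a | A a]].

Lemma least_constantE (A : R -> Prop) (a : R) :
  A a -> (forall b, A b -> a <= b) -> least_constant A = a%:E.
Proof.
move=> Aa lea; apply/eqP; rewrite eq_le; apply/andP; split.
  by apply: ereal_inf_lbound; exists a.
by apply: le_ereal_inf_tmp => _ [b Ab <-]; rewrite lee_fin; exact: lea.
Qed.

Definition poincare_constant mu Q : \bar R :=
  least_constant (poincare_admissible mu Q).

Definition log_sobolev_constant mu Q : \bar R :=
  least_constant (log_sobolev_admissible mu Q).

End FiniteChains.

Section BipartiteGraphs.
Variables n d : nat.

(* A bipartite graph without multiple edges on n labelled left and n labelled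
   right vertices is its edge set; [(i, j)] joins left i to right j. *)
Definition regular_edges (E : {set 'I_n * 'I_n}) : bool :=
  [forall i, #|[set j | (i, j) \in E]| == d] &&
  [forall j, #|[set i | (i, j) \in E]| == d].

Record regular_bipartite := RegularBipartite {
  edges :> {set 'I_n * 'I_n};
  edges_regular : regular_edges edges }.

HB.instance Definition _ := [isSub for edges].
HB.instance Definition _ := [Finite of regular_bipartite by <:].

Implicit Types (G : regular_bipartite) (e : 'I_n * 'I_n).

Definition switching_admissible G e e' : bool :=
  [&& e \in edges G, e' \in edges G, e.1 != e'.1, e.2 != e'.2,
      (e.1, e'.2) \notin edges G & (e'.1, e.2) \notin edges G].

Definition switching G e e' : {set 'I_n * 'I_n} :=
  (edges G :\: [set e; e']) :|: [set (e.1, e'.2); (e'.1, e.2)].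

Definition switch_neighbours G : {set regular_bipartite} :=
  [set G' | [exists e, [exists e',
    switching_admissible G e e' && (edges G' == switching G e e')]]].

Variable R : realType.

Definition pi_u G : R := #|{: regular_bipartite}|%:R^-1.

Definition switch_rate : R := ((n * d)%:R * ((n * d)%:R - 1) / 2)^-1.

Definition Q_u G1 G2 : R :=
  if G2 \in switch_neighbours G1 then switch_rate
  else if G2 == G1 then - (#|switch_neighbours G1|%:R * switch_rate)
  else 0.

End BipartiteGraphs.

Arguments pi_u {n d} R G.
Arguments Q_u {n d} R G1 G2.

(* Main.v *)
Require Import Defs.
From mathcomp Require Import all_boot all_order all_algebra.
From mathcomp Require Import all_classical all_reals all_analysis.
From mathcomp Require Import fingroup perm ring lra zify.
Import Order.TTheory GRing.Theory Num.Theory.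
Local Open Scope ring_scope.

(** Any function [f] with E(f,f) > 0 bounds the two constants from below, by
    Var(f) / E(f,f) and Ent(f^2) / E(f,f).  The test function is the indicator of
    the event that a fixed pair [(i, j)] is an edge of the graph.  Relabelling
    right vertices preserves the uniform measure, so the [n] possible edges at
    [i] are equally likely; as exactly [d] of them are present, each has
    probability p = d / n ([edge_probability]).  Hence
      Var(f) = p (1 - p)   and   Ent(f^2) = - p ln p = p ln (n / d).

    The energy only sees switchings that change the status of [(i, j)].
    - If [(i, j)] is an edge, a switching removing it pairs it with an edge
      whose right end is not adjacent to [i]: at most (n - d) d choices
      ([card_switchings_removing]).
    - If [(i, j)] is not an edge, a switching creating it uses an edge at [i]
      and an edge at [j]: at most d^2 choices ([card_switchings_adding]).
    With weights p and 1 - p these two bounds contribute the same amount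
    p d (n - d), so that
      E(f,f) <= p d (n - d) * 2 / (nd (nd - 1))      ([dirichlet_edge_le]).
    The variance ratio is then at least (nd - 1) / 2 >= nd / 4, and the entropy
    ratio at least ln (n / d) * nd (nd - 1) / (2 d (n - d)), where
    nd - 1 >= d (n - d) gives the claim.

    Dividing by E(f,f) is legitimate because Var(f) and Ent(f^2) are positive,
    which forces E(f,f) > 0 as soon as some finite constant is admissible.  The
    measure has total mass 1 because a [d]-regular bipartite graph exists, for
    instance a circulant one ([regular_bipartite_inhabited]). *)

(** * Indicator test functions on a finite chain *)

(** Here [v] is the variance or entropy of a test function of energy [e], and
    [c] is at most [v / e].  The form [c * e <= v] follows from an upper bound
    on [e] alone; that [e] is nonzero is deduced from an admissible [a]. *)
Lemma least_constant_ge_ratio (R : realType) (A : R -> Prop) (v e c : R) :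
  0 < v -> 0 <= e -> c * e <= v -> (forall a, A a -> v <= a * e) ->
  (c%:E <= least_constant A)%E.
Proof.
move=> v0 e0 cev Av; apply: le_ereal_inf_tmp => _ [a Aa <-]; rewrite lee_fin.
have vae := Av a Aa.
have e_gt0 : 0 < e.
  rewrite lt_neqAle e0 andbT eq_sym; apply/eqP => e_eq0.
  by move: vae; rewrite e_eq0 mulr0 leNgt v0.
by rewrite -(ler_pM2r e_gt0) (le_trans cev).
Qed.

Lemma sum_indicator_card (T : finType) (P : pred T) :
  (\sum_x P x)%N = #|[set x | P x]|.
Proof.
by rewrite -sum1dep_card [RHS]big_mkcond; apply: eq_bigr => x _; case: (P x).
Qed.

Section Indicators.
Variables (R : realType) (S : finType) (mu : S -> R) (P : pred S).
Hypothesis mu1 : \sum_x mu x = 1.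

Let f (x : S) : R := (P x)%:R.
Let p : R := expectation_fin mu f.

Lemma variance_indicator : variance_fin mu f = p * (1 - p).
Proof.
have toggle x y : mu x * mu y * (f x - f y) ^+ 2 =
    mu x * f x * mu y + mu x * (mu y * f y)
    - 2 * (mu x * f x) * (mu y * f y).
  by rewrite /f; case: (P x); case: (P y); rewrite /=; ring.
rewrite /variance_fin.
under eq_bigr => x _.
  under eq_bigr => y _ do rewrite toggle.
  rewrite sumrB big_split /= -!mulr_sumr mu1 mulr1.
  rewrite -[\sum_i mu i * f i]/p.
  over.
rewrite sumrB big_split /= -!mulr_suml mu1 -mulr_sumr.
by rewrite -[\sum_i mu i * f i]/p; field.
Qed.

Lemma entropy_indicator : entropy_sqr mu f = - (p * ln p).
Proof.
have f_idem x : f x ^+ 2 = f x.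
  by rewrite /f; case: (P x); rewrite ?expr1n ?expr0n.
rewrite /entropy_sqr.
have -> : expectation_fin mu (fun y => f y ^+ 2) = p.
  by apply: eq_bigr => x _; rewrite f_idem.
rewrite /expectation_fin -mulrN mulr_suml; apply: eq_bigr => x _.
by rewrite f_idem /f; case: (P x); rewrite /= ?ln1; ring.
Qed.

End Indicators.

(** * Regular bipartite graphs: degrees, existence, probability of an edge *)

Section Graphs.
Variables (n d : nat).
Implicit Types (G : regular_bipartite n d) (i j : 'I_n) (e : 'I_n * 'I_n).

Lemma left_degree G i : #|[set j | (i, j) \in edges G]| = d.
Proof. by have /andP[/forallP/(_ i)/eqP] := edges_regular G. Qed.

Lemma right_degree G j : #|[set i | (i, j) \in edges G]| = d.
Proof. by have /andP[_ /forallP/(_ j)/eqP] := edges_regular G. Qed.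

Lemma card_edges_right G (B : {set 'I_n}) :
  #|[set e in edges G | e.2 \in B]| = (#|B| * d)%N.
Proof.
rewrite -sum1_card (partition_big (fun e => e.2) (mem B)) /=; last first.
  by move=> e; rewrite inE => /andP[].
rewrite -sum_nat_const; apply: eq_bigr => j jB.
rewrite sum1dep_card -[RHS](right_degree G j).
rewrite -[RHS](card_imset _ (f := fun i => (i, j))); last by move=> ? ? [].
apply: eq_card => -[i j']; rewrite !inE /=.
apply/idP/imsetP => [/andP[/andP[ijG _] /eqP jj']|[i' + [-> ->]]].
  by exists i; rewrite ?inE -jj'.
by rewrite inE => ->; rewrite jB eqxx.
Qed.

Lemma relabel_regular (s : {perm 'I_n}) G :
  regular_edges d [set e | (e.1, s e.2) \in edges G].
Proof.
apply/andP; split; apply/forallP => k; apply/eqP.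
  rewrite -[RHS](left_degree G k) -[RHS](card_preimset _ (@perm_inj _ s)).
  by apply: eq_card => j; rewrite !inE.
by rewrite -[RHS](right_degree G (s k)); apply: eq_card => i; rewrite !inE.
Qed.

Definition relabel s G := RegularBipartite (relabel_regular s G).

Lemma relabel_inj s : injective (relabel s).
Proof.
move=> G H /(congr1 (@edges _ _)) /setP GH; apply/val_inj/setP => -[i j].
by have := GH (i, (s^-1)%g j); rewrite !inE /= permKV.
Qed.

(** Transposing the right vertices [j] and [j'] shows that all pairs [(i, j')]
    are edges of equally many graphs; counting the edges at [i] over all graphs
    then gives [d] per graph. *)
Lemma card_graphs_containing_edge i j :
  (n * #|[set G : regular_bipartite n d | (i, j) \in edges G]|
   = d * #|{: regular_bipartite n d}|)%N.
Proof.
have same j' : #|[set G : regular_bipartite n d | (i, j') \in edges G]|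
    = #|[set G : regular_bipartite n d | (i, j) \in edges G]|.
  rewrite -[RHS](card_preimset _ (@relabel_inj (tperm j j'))).
  by apply: eq_card => G; rewrite !inE /= tpermL.
rewrite -[X in (X * _)%N]card_ord -sum_nat_const.
under eq_bigr => j' _ do rewrite -(same j') -sum1dep_card big_mkcond /=.
rewrite exchange_big /= mulnC -sum_nat_const; apply: eq_bigr => G _.
rewrite -[RHS](left_degree G i) -sum1dep_card [RHS]big_mkcond.
by apply: eq_bigr.
Qed.

(** * Switchings that change the status of a given edge *)

Lemma switchingC G e e' : switching G e e' = switching G e' e.
Proof.
by rewrite /switching [in LHS](finset.setUC [set e])
  [in LHS](finset.setUC [set (e.1, e'.2)]).
Qed.

(** Neighbours are counted as graphs, so a set of switching parameters that
    produces them all bounds their number; distinct parameters may give the same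
    graph. *)
Lemma card_switch_neighbours_le (T : finType) (g : T -> {set 'I_n * 'I_n})
    (C : {set T}) (B : {set regular_bipartite n d}) :
  (forall H, H \in B -> exists2 t, t \in C & edges H = g t) ->
  (#|B| <= #|C|)%N.
Proof.
move=> BC; rewrite -(card_imset (mem B) (val_inj : injective (@edges n d))).
apply: leq_trans (leq_imset_card g (mem C)).
apply/subset_leq_card/fintype.subsetP.
by move=> _ /imsetP[H /BC[t tC Ht] ->]; apply/imsetP; exists t.
Qed.

(** One of the two switched edges must be [(i, j)] itself, and admissibility
    forbids the right end of the other one from being adjacent to [i]: that
    edge ends in one of [n - d] right vertices, each of degree [d]. *)
Lemma card_switchings_removing G i j : (i, j) \in edges G ->
  (#|[set H in switch_neighbours G | (i, j) \notin edges H]| <= (n - d) * d)%N.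
Proof.
move=> ijG; set N := [set k | (i, k) \in edges G].
have <- : #|[set e in edges G | e.2 \in ~: N]| = ((n - d) * d)%N.
  by rewrite card_edges_right cardsCs finset.setCK card_ord left_degree.
apply: (card_switch_neighbours_le _ (switching G (i, j))) => H.
rewrite !inE => /andP[/existsP[e /existsP[e' /andP[adm /eqP HE]]] ijH].
wlog eij : e e' adm HE / e = (i, j).
  move=> wl; move: (ijH); rewrite {1}HE !inE ijG andbT negb_or negbK => /andP[].
  case/orP=> /eqP eij _; first exact: (wl e e' adm HE (esym eij)).
  apply: (wl e' e) => //; last by rewrite switchingC.
  by case/and5P: adm => ? ? ? ? /andP[? ?]; apply/and5P; split;
    rewrite // 1?eq_sym //; apply/andP.
subst e; exists e' => //.
by case/and5P: adm => _ e'G _ _ /andP[/= ije' _]; rewrite !inE e'G.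
Qed.

(** Creating [(i, j)] requires switching some [(i, k)] with some [(l, j)]; such
    a switching is determined by a neighbour [k] of [i] and a neighbour [l] of
    [j]. *)
Lemma card_switchings_adding G i j : (i, j) \notin edges G ->
  (#|[set H in switch_neighbours G | (i, j) \in edges H]| <= d * d)%N.
Proof.
move=> ijG.
have <- : #|finset.setX [set k | (i, k) \in edges G]
                        [set k | (k, j) \in edges G]|
    = (d * d)%N by rewrite cardsX left_degree right_degree.
apply: (card_switch_neighbours_le _
  (fun t => switching G (i, t.1) (t.2, j))) => H.
rewrite !inE => /andP[/existsP[e /existsP[e' /andP[adm /eqP HE]]] ijH].
case/and5P: adm => eG e'G _ _ _.
move: ijH; rewrite HE !inE (negbTE ijG) andbF /=.
case/orP => /eqP[iE jE].
  exists (e.2, e'.1); rewrite ?inE /= iE jE -!surjective_pairing //.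
  by rewrite eG.
exists (e'.2, e.1); rewrite ?inE /= iE jE -!surjective_pairing.
  by rewrite e'G.
by rewrite switchingC.
Qed.

End Graphs.

(** The circulant graph joining [i] to [i], [i + 1], ..., [i + d - 1] modulo [n]
    is [d]-regular, since the translations and reflections of Z/n are
    injective. *)
Lemma regular_bipartite_inhabited (n d : nat) : (0 < n)%N -> (d <= n)%N ->
  (0 < #|{: regular_bipartite n d}|)%N.
Proof.
case: n => // n _ dn.
pose D := [set k : 'I_n.+1 | (k < d)%N].
have cardD : #|D| = d.
  by rewrite -sum1dep_card -(big_ord_widen _ (fun=> 1%N) dn) sum1_card card_ord.
have reg : regular_edges d [set e : 'I_n.+1 * 'I_n.+1 | e.2 - e.1 \in D].
  apply/andP; split; apply/forallP => k; apply/eqP; rewrite -[RHS]cardD.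
    rewrite -[RHS](card_preimset _ (addIr (- k))).
    by apply: eq_card => j; rewrite !inE.
  rewrite -[RHS](card_preimset _ (inj_comp (addrI k) (@oppr_inj 'I_n.+1))).
  by apply: eq_card => i; rewrite !inE.
by apply/card_gt0P; exists (RegularBipartite reg).
Qed.

(** * Energy of the edge indicator *)

Section Energy.
Variables (R : realType) (n d : nat).
Hypotheses (d_gt0 : (0 < d)%N) (dn : (d <= n)%N).
Variables (i j : 'I_n).

Let Omega := regular_bipartite n d.
Let has_edge : pred Omega := fun G => (i, j) \in edges G.
Let f (G : Omega) : R := (has_edge G)%:R.

Let N_neq0 : #|{: Omega}|%:R != 0 :> R.
Proof.
by rewrite pnatr_eq0 -lt0n regular_bipartite_inhabited // (leq_trans d_gt0).
Qed.

Lemma pi_u_total : \sum_G @pi_u n d R G = 1.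
Proof. by rewrite /pi_u sumr_const -[LHS]mulr_natl mulfV. Qed.

Lemma edge_probability : expectation_fin (@pi_u n d R) f = d%:R / n%:R.
Proof.
have n_neq0 : n%:R != 0 :> R by rewrite pnatr_eq0 -lt0n (leq_trans d_gt0).
rewrite /expectation_fin /pi_u -mulr_sumr -natr_sum.
have -> : (\sum_G has_edge G)%N = #|[set G : Omega | (i, j) \in edges G]|.
  exact: sum_indicator_card.
have /(congr1 (fun m => m%:R : R)) := card_graphs_containing_edge n d i j.
rewrite !natrM => cnt.
apply: (mulfI n_neq0); rewrite mulrCA cnt mulrCA mulVf // mulr1.
by rewrite mulrCA divff // mulr1.
Qed.

Lemma switch_rate_ge0 : 0 <= switch_rate n d R.
Proof.
rewrite invr_ge0 divr_ge0 // mulr_ge0 ?ler0n // subr_ge0 ler1n muln_gt0 d_gt0.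
by rewrite (leq_trans d_gt0).
Qed.

Lemma dirichlet_term (G H : Omega) :
  Q_u R G H * (f G - f H) ^+ 2 =
  ((H \in switch_neighbours G) && (has_edge G != has_edge H))%:R
    * switch_rate n d R.
Proof.
rewrite /Q_u /f; case: ifP => _ /=.
  by case: (has_edge G); case: (has_edge H); rewrite /=; ring.
by case: eqP => [->|_]; rewrite ?subrr /=; ring.
Qed.

Lemma dirichlet_edge_ge0 : 0 <= dirichlet (@pi_u n d R) (@Q_u n d R) f.
Proof.
rewrite mulr_ge0 ?invr_ge0 //; apply: sumr_ge0 => G _; apply: sumr_ge0 => H _.
by rewrite dirichlet_term !mulr_ge0 ?ler0n ?switch_rate_ge0 // invr_ge0.
Qed.

(** The factor 1/2 in the Dirichlet form is absorbed because the two kinds of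
    switchings contribute equally:
    (d / n) (n - d) d = (1 - d / n) d^2. *)
Lemma dirichlet_edge_le :
  dirichlet (@pi_u n d R) (@Q_u n d R) f
  <= switch_rate n d R * (d%:R * (n%:R - d%:R) * (d%:R / n%:R)).
Proof.
have rate0 := switch_rate_ge0.
have n_neq0 : n%:R != 0 :> R by rewrite pnatr_eq0 -lt0n (leq_trans d_gt0).
(* [bound G] majorizes the number of neighbours of [G] on which [f] differs
   from [f G]. *)
pose bound (G : Omega) : R :=
  f G * ((n%:R - d%:R) * d%:R) + (1 - f G) * (d%:R * d%:R).
have row G : \sum_H Q_u R G H * (f G - f H) ^+ 2 * pi_u R G
    <= switch_rate n d R * (pi_u R G * bound G).
  under eq_bigr => H _ do rewrite dirichlet_term.
  rewrite -!mulr_suml -natr_sum mulrAC mulrC ler_wpM2l // mulrC ler_wpM2l //.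
    by rewrite invr_ge0.
  have -> : (\sum_H ((H \in switch_neighbours G)
                     && (has_edge G != has_edge H)))%N
      = #|[set H in switch_neighbours G | has_edge G != has_edge H]|.
    exact: sum_indicator_card.
  rewrite /bound /f; case: (boolP (has_edge G)) => [ijG|ijG] /=.
    rewrite subrr mul0r addr0 mul1r -natrB // -natrM ler_nat.
    exact: card_switchings_removing.
  rewrite subr0 mul0r add0r mul1r -natrM ler_nat.
  apply: leq_trans (card_switchings_adding _ _ _ _ _ ijG).
  by apply/eq_leq/eq_card => H; rewrite !inE -/(has_edge H); case: (has_edge H).
have mean : \sum_G pi_u R G * bound G
    = 2 * (d%:R * (n%:R - d%:R) * (d%:R / n%:R)).
  have split_bound G : pi_u R G * bound G =
      pi_u R G * f G * ((n%:R - d%:R) * d%:R) + pi_u R G * (d%:R * d%:R)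
      - pi_u R G * f G * (d%:R * d%:R) by rewrite /bound; ring.
  under eq_bigr => G _ do rewrite split_bound.
  rewrite sumrB big_split /= -!mulr_suml.
  rewrite -/(expectation_fin _ _) edge_probability pi_u_total.
  by field.
rewrite /dirichlet mulrC ler_pdivrMr //.
apply: le_trans (ler_sum _ (fun G _ => row G)) _.
by rewrite -mulr_sumr mean; lra.
Qed.

End Energy.

Theorem proposition2p4 (R : realType) (n d : nat)
  (hd : (2 <= d)%N) (hdn : (2 * d <= n)%N) :
  (((n * d)%:R / 4)%:E
     <= poincare_constant (@pi_u n d R) (@Q_u n d R))%E /\
  ((2^-1 * (n * d)%:R * ln (n%:R / d%:R))%:E
     <= log_sobolev_constant (@pi_u n d R) (@Q_u n d R))%E.
Proof.
have d_gt0 : (0 < d)%N by lia.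
have dn : (d <= n)%N by lia.
have n_gt0 : (0 < n)%N by lia.
pose i := Ordinal n_gt0.
pose f (G : regular_bipartite n d) : R := ((i, i) \in edges G)%:R.
have E_ge0 := dirichlet_edge_ge0 R n d d_gt0 dn i i.
have E_le := dirichlet_edge_le R n d d_gt0 dn i i.
have pE := edge_probability R n d d_gt0 dn i i.
have varE := variance_indicator R _ _ (fun G => (i, i) \in edges G)
  (pi_u_total R n d d_gt0 dn).
have entE := entropy_indicator R _ (@pi_u n d R) (fun G => (i, i) \in edges G).
rewrite -/f in E_ge0 E_le pE varE entE.
rewrite pE in varE entE.
set E := dirichlet _ _ _ in E_ge0 E_le.
pose D : R := d%:R; pose M : R := n%:R.
have D2 : 2 <= D by rewrite (ler_nat R 2 d).
have MD : 2 * D <= M by rewrite -natrM ler_nat.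
have D0 : 0 < D by lra.
have M0 : 0 < M by lra.
have MD1 : 0 < M * D - 1 by nra.
(* Variance, entropy and energy bound share the factor [D / M]; [r] is what
   remains of the bound on [M * D * E].  The claims reduce to
   [r <= 4 * (1 - D / M)], from M D <= 2 (M D - 1), and to [r <= 2], from
   D (M - D) <= M D - 1. *)
pose r := 2 * (D * (M - D)) / (M * D - 1).
have scaled : M * D * E <= D / M * r.
  have -> : D / M * r = M * D * (switch_rate n d R * (D * (M - D) * (D / M))).
    rewrite /r /switch_rate natrM -/D -/M; field.
    by rewrite !gt_eqF.
  by rewrite ler_wpM2l // mulr_ge0 // ltW.
have r_le2 : r <= 2 by rewrite ler_pdivrMr //; nra.
have r_le_var : r <= 4 * (1 - D / M).
  have -> : 4 * (1 - D / M) = 2 * (M - D) * (2 / M) by field; rewrite gt_eqF.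
  have -> : r = 2 * (M - D) * (D / (M * D - 1)).
    by rewrite /r; field; rewrite gt_eqF.
  rewrite ler_wpM2l //; first by lra.
  by rewrite ler_pdivrMr // mulrAC ler_pdivlMr //; nra.
have p_gt0 : 0 < D / M by rewrite divr_gt0.
have ln_gt0 : 0 < ln (M / D) by rewrite ln_gt0 // ltr_pdivlMr //; lra.
rewrite natrM -/D -/M; split.
  apply: (least_constant_ge_ratio _ _ (D / M * (1 - D / M)) E) => //.
  - by rewrite mulr_gt0 // subr_gt0 ltr_pdivrMr //; lra.
  - by have := ler_wpM2l (ltW p_gt0) r_le_var; lra.
  - by move=> a; rewrite -varE => /(_ f).
apply: (least_constant_ge_ratio _ _ (D / M * ln (M / D)) E) => //.
- by rewrite mulr_gt0.
- have scaled2 : M * D * E <= 2 * (D / M).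
    by have := ler_wpM2l (ltW p_gt0) r_le2; lra.
  by have := ler_wpM2r (ltW ln_gt0) scaled2; lra.
- move=> a /(_ f); rewrite entE -mulrN.
  by rewrite -lnV ?posrE // invf_div.
Qed.
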